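(* Let $m,l,n,k$ be positive integers with $m\geq n$ and $ml=nk$, and let $G=G(X,Y,E)$ be a bipartite graph with bipartition $(X,Y)$ such that $|X|=m$, $|Y|=n$, every vertex of $X$ has degree $l$ and every vertex of $Y$ has degree $k$ (i.e. $G\in Bip(m,l,n,k)$). Then $w_Y(G)=k$ and $w_X(G)\leq l\cdot\left\lceil\frac{m}{l}\right\rceil$.
   Context: All graphs are finite, undirected, without loops or multiple edges. An interval is a nonempty set of consecutive integers; $[p,q]$ denotes the interval with minimum $p$ and maximum $q$. A proper edge $t$-coloring of a graph $G$ is a function $\varphi:E(G)\to[1,t]$ such that every color in $[1,t]$ is used and no two adjacent edges receive the same color. For a vertex $x$, its spectrum under $\varphi$ is $S_G(x,\varphi)=\{\varphi(e): e\in E(G),\ e \text{ incident with } x\}$. A proper edge coloring $\varphi$ is interval in $x$ if $S_G(x,\varphi)$ is an interval, and interval on a set $R\subseteq V(G)$ if it is interval in every $x\in R$. A subset $R\subseteq V(G)$ has the $i$-property if some proper edge $t$-coloring of $G$ (for some $t$) is interval on $R$; for such $R$, $w_R(G)$ denotes the minimum $t$ such that there exists a proper edge $t$-coloring of $G$ interval on $R$. *)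

(* Defs.v *)
From HB Require Import structures.
From mathcomp Require Import all_boot all_order all_algebra.

Set Implicit Arguments.
Unset Strict Implicit.
Unset Printing Implicit Defensive.

Record sgraph := SGraph {
  vertex :> finType;
  adj : rel vertex;
  adj_sym : symmetric adj;
  adj_irrefl : irreflexive adj }.

Definition edges (G : sgraph) : {set {set G}} :=
  [set [set p.1; p.2] | p in [set p : G * G | adj p.1 p.2]].

Definition edge (G : sgraph) := {e : {set G} | e \in edges G}.

Definition degree (G : sgraph) (x : G) : nat := #|[set y | adj x y]|.

Definition incident (G : sgraph) (e : edge G) (x : G) : bool := x \in val e.

Definition edge_adjacent (G : sgraph) (e f : edge G) : bool :=
  (e != f) && [exists x, incident e x && incident f x].

(* Colors are the values 1, ..., t of 'I_t.+1; the value 0 is never used. *)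
Definition proper_coloring (G : sgraph) (t : nat)
    (phi : {ffun edge G -> 'I_t.+1}) : bool :=
  [&& [forall e, 0 < phi e],
      [forall c : 'I_t.+1, (0 < c) ==> [exists e, phi e == c]]
    & [forall e, forall f, edge_adjacent e f ==> (phi e != phi f)]].

Definition spectrum (G : sgraph) (t : nat) (phi : {ffun edge G -> 'I_t.+1})
    (x : G) : {set 'I_t.+1} :=
  [set phi e | e in [set e | incident e x]].

(* The condition p <= q makes intervals nonempty. *)
Definition is_interval (t : nat) (S : {set 'I_t.+1}) : bool :=
  [exists p : 'I_t.+1, exists q : 'I_t.+1,
     (p <= q) && (S == [set c : 'I_t.+1 | p <= c <= q])].

Definition interval_on (G : sgraph) (t : nat) (phi : {ffun edge G -> 'I_t.+1})
    (R : {set G}) : bool :=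
  [forall x in R, is_interval (spectrum phi x)].

Definition interval_colorable (G : sgraph) (R : {set G}) (t : nat) : bool :=
  [exists phi : {ffun edge G -> 'I_t.+1},
     proper_coloring phi && interval_on phi R].

Definition i_property (G : sgraph) (R : {set G}) : Prop :=
  exists t, interval_colorable R t.

(* w_R(G) is only meaningful when R has the i-property, so it takes a proof of
   this as its argument; its value does not depend on that proof. *)
Definition w (G : sgraph) (R : {set G}) (hR : i_property R) : nat :=
  ex_minn hR.

Definition bipartition (G : sgraph) (X Y : {set G}) : Prop :=
  [/\ X :|: Y = [set: G], X :&: Y = set0
    & forall x y : G, adj x y ->
        (x \in X /\ y \in Y) \/ (x \in Y /\ y \in X)].

Definition Bip (m l n k : nat) (G : sgraph) (X Y : {set G}) : Prop :=
  [/\ bipartition X Y, #|X| = m, #|Y| = n,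
      {in X, forall x, degree x = l}
    & {in Y, forall y, degree y = k}].

(* Main.v *)
Require Import Defs.
From HB Require Import structures.
From mathcomp Require Import all_boot all_order all_algebra.
From mathcomp Require Import zify.

(* A bipartite graph of maximum degree d has a proper edge coloring with d colors
   (Koenig).  Since n <= m gives l <= k, this provides k colors, and every vertex of Y
   sees all of them; fewer do not suffice, as such a vertex has degree k.  For X,
   cut X into ceil(m/l) groups of at most l vertices: the edges at one group
   form a graph of maximum degree l, which gets l colors from a block of its own,
   and every vertex of the group sees its whole block. *)

(** * Koenig's edge coloring theorem, by alternating chains *)

Section BipartiteEdgeColoring.
Variables (A B C : finType).
Implicit Types (E : {set A * B}) (c : A -> B -> C).

Definition proper_on E c :=
  (forall x y y', (x, y) \in E -> (x, y') \in E -> c x y = c x y' -> y = y') /\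
  (forall x x' y, (x, y) \in E -> (x', y) \in E -> c x y = c x' y -> x = x').

Lemma exists_missing (T : finType) (S : {set T}) (f : T -> C) :
  #|S| < #|C| -> exists a, forall y, y \in S -> f y != a.
Proof.
move=> ltSC; have: ~~ (setT \subset f @: S).
  apply/negP => /subset_leq_card; rewrite cardsT => h.
  by have := leq_trans ltSC (leq_trans h (leq_imset_card f S)); rewrite ltnn.
case/subsetPn => a _ aNS; exists a => y yS; apply: contraNneq aNS => <-.
exact: imset_f.
Qed.

(* Exchanging the colors u and v on the alternating chain that leaves b along
   an edge of color u.  By bipartiteness the chain enters A only along edges
   of color u, so it avoids a. *)
Lemma kempe_swap E c a b u v :
    proper_on E c -> (forall y, (a, y) \in E -> c a y != u) ->
    (forall x, (x, b) \in E -> c x b != v) ->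
  exists c', [/\ proper_on E c', forall y, (a, y) \in E -> c' a y != u
               & forall x, (x, b) \in E -> c' x b != u].
Proof.
move=> [cA cB] au bv.
(* One step of [r] follows two edges of the chain, of color [v] and then [u]; so [S] is the set of
   chain vertices in [A]. *)
pose r := [rel x x' | [exists y, [&& (x, y) \in E, c x y == v,
                                     (x', y) \in E & c x' y == u]]].
pose S := [set x | [exists x0, [&& (x0, b) \in E, c x0 b == u
                                   & connect r x0 x]]].
have S0 x : (x, b) \in E -> c x b = u -> x \in S.
  move=> xb cx; rewrite inE; apply/existsP; exists x.
  by rewrite xb cx eqxx connect0.
have S1 x x' y : x \in S -> (x, y) \in E -> c x y = v ->
    (x', y) \in E -> c x' y = u -> x' \in S.
  rewrite !inE => /existsP[x0 /and3P[x0b cx0 con]] xy cxy x'y cx'y.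
  apply/existsP; exists x0; rewrite x0b cx0 /=.
  apply: connect_trans con (connect1 _); apply/existsP; exists y.
  by rewrite xy cxy x'y cx'y !eqxx.
have Slast x : x \in S -> ((x, b) \in E /\ c x b = u) \/
    exists x' y, [/\ x' \in S, (x', y) \in E, c x' y = v, (x, y) \in E
                   & c x y = u].
  rewrite inE => /existsP[x0 /and3P[x0b /eqP cx0 /connectP[p pth ->]]].
  case/lastP: p pth => [|p z] /=; first by left.
  rewrite rcons_path last_rcons => /andP[pth].
  case/existsP => y /and4P[? /eqP ? ? /eqP ?]; right.
  exists (last x0 p), y; split=> //.
  rewrite inE; apply/existsP; exists x0; rewrite x0b cx0 eqxx /=.
  by apply/connectP; exists p.
pose sw z := if z == u then v else if z == v then u else z.
have swK : involutive sw.
  move=> z; rewrite /sw; case: (eqVneq z u) => [->|zu].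
    by rewrite eqxx; case: (eqVneq v u) => [->|].
  by case: (eqVneq z v) => [->|zv]; rewrite ?eqxx // (negPf zu) (negPf zv).
pose c' x y := if x \in S then sw (c x y) else c x y.
(* A recolored and an unchanged edge at [y] cannot clash. If the first had color [u], the chain came
   to [x] through [y], from [b] itself, which misses [v], or from the [v]-neighbor of [y], which is
   in [S]; if it had color [v], the chain goes on to the [u]-neighbor. *)
have mixed x x' y : x \in S -> x' \notin S -> (x, y) \in E ->
    (x', y) \in E -> sw (c x y) = c x' y -> x = x'.
  move=> xS x'S xy x'y; rewrite /sw; case: eqP => [cxy | _].
    move=> cx'y; case: (Slast _ xS) => [[xb cxb] | [x2 [y2 [x2S x2y2 cx2 xy2 cxy2]]]].
      have yb : y = b by apply: (cA x) => //; rewrite cxy.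
      by move: (bv x'); rewrite -yb -cx'y eqxx => /(_ x'y).
    have yy2 : y = y2 by apply: (cA x) => //; rewrite cxy.
    subst y2; have xx : x2 = x' by apply: (cB _ _ y) => //; rewrite cx2.
    by rewrite -xx x2S in x'S.
  case: eqP => [cxy cx'y | _]; last exact: cB.
  by rewrite (S1 x x' y) in x'S.
exists c'; split.
- split=> [x y y' xy xy' | x x' y xy x'y]; rewrite /c'.
    by case: ifP => _; [move/(can_inj swK); exact: cA | exact: cA].
  case: ifP => xS; case: ifP => x'S.
  + by move/(can_inj swK); exact: cB.
  + by apply: mixed => //; rewrite x'S.
  + by move/esym=> e; apply/esym/(mixed _ _ y) => //; rewrite xS.
  + exact: cB.
- move=> y ay; rewrite /c'; case: ifP => [aS | _]; last exact: au.
  case: (Slast _ aS) => [[ab cab] | [x' [y' [_ _ _ ay' cay']]]].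
    by move: (au b ab); rewrite cab eqxx.
  by move: (au y' ay'); rewrite cay' eqxx.
(* At [b], a recolored edge of new color [u] had color [v], which [b] misses; an unchanged edge of
   color [u] would start the chain. *)
- move=> x xb; rewrite /c'; case: ifP => xS.
    apply: contra (bv x xb) => /eqP h.
    by rewrite -(swK (c x b)) h /sw eqxx.
  by apply: contraFneq xS; apply: S0.
Qed.

(** Induction on the number of edges. Without the edge [(a, b)], some [u] is missing at [a] and some
    [v] at [b]; the swap makes [u] missing at both, and [(a, b)] receives it. *)
Lemma koenig_edge_coloring E (c0 : C) :
    (forall x, #|[set y | (x, y) \in E]| <= #|C|) ->
    (forall y, #|[set x | (x, y) \in E]| <= #|C|) ->
  exists c, proper_on E c.
Proof.
elim/ltn_ind: {E}#|E| {-2}E (erefl #|E|) => k IH E Ek dA dB.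
case: (set_0Vmem E) => [-> | [[a b] abE]].
  by exists (fun _ _ => c0); split=> ? ? ?; rewrite inE.
pose F := E :\ (a, b).
have FE x y : (x, y) \in F -> (x, y) \in E by rewrite inE => /andP[].
have sA x : [set y | (x, y) \in F] \subset [set y | (x, y) \in E].
  by apply/subsetP => y; rewrite !(inE, in_setD1) => /andP[].
have sB y : [set x | (x, y) \in F] \subset [set x | (x, y) \in E].
  by apply/subsetP => x; rewrite !(inE, in_setD1) => /andP[].
have [c pc] : exists c, proper_on F c.
  apply: (IH #|F| _ F) => //.
  - by rewrite -Ek (cardsD1 (a, b) E) abE.
  - by move=> x; apply: leq_trans (subset_leq_card (sA x)) (dA x).
  - by move=> y; apply: leq_trans (subset_leq_card (sB y)) (dB y).
have ltA : #|[set y | (a, y) \in F]| < #|C|.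
  apply: leq_trans (dA a); apply: proper_card; rewrite properE sA.
  by apply/subsetPn; exists b; rewrite inE // !inE eqxx.
have ltB : #|[set x | (x, b) \in F]| < #|C|.
  apply: leq_trans (dB b); apply: proper_card; rewrite properE sB.
  by apply/subsetPn; exists a; rewrite inE // !inE eqxx.
have [u uA] := exists_missing _ _ (c a) ltA.
have [v vB] := exists_missing _ _ (c^~ b) ltB.
have [c1 [[c1A c1B] c1a c1b]] : exists c1, [/\ proper_on F c1,
    forall y, (a, y) \in F -> c1 a y != u
  & forall x, (x, b) \in F -> c1 x b != u].
  apply: (@kempe_swap F c a b u v) => // [y ay | x xb].
    by apply: uA; rewrite inE.
  by apply: vB; rewrite inE.
pose c2 x y := if (x, y) == (a, b) then u else c1 x y.
have EF x y : (x, y) \in E -> (x, y) != (a, b) -> (x, y) \in F.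
  by move=> xy ne; rewrite in_setD1 ne.
exists c2; split=> [x y y' xy xy' | x x' y xy x'y]; rewrite /c2.
- have [[ex ey]|ne] := eqVneq (x, y) (a, b);
  have [[ex' ey']|ne'] := eqVneq (x, y') (a, b); subst=> //.
  + by move=> h; move: (c1a y' (EF _ _ xy' ne')); rewrite -h eqxx.
  + by move=> h; move: (c1a y (EF _ _ xy ne)); rewrite h eqxx.
  + by apply: c1A; apply: EF.
- have [[ex ey]|ne] := eqVneq (x, y) (a, b);
  have [[ex' ey']|ne'] := eqVneq (x', y) (a, b); subst=> //.
  + by move=> h; move: (c1b x' (EF _ _ x'y ne')); rewrite -h eqxx.
  + by move=> h; move: (c1b x (EF _ _ xy ne)); rewrite h eqxx.
  + by apply: c1B; apply: EF.
Qed.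

End BipartiteEdgeColoring.

(** * From functions on ordered pairs of vertices to edge colorings of a graph *)

Section GraphColoring.
Variable G : sgraph.

Lemma set2_inj (T : finType) (x y z : T) :
  x != y -> [set x; y] = [set x; z] -> y = z.
Proof.
move=> xy /setP/(_ y); rewrite !inE eqxx orbT [y == x]eq_sym (negPf xy) /=.
by move/esym/eqP.
Qed.

Lemma adj_neq (x y : G) : adj x y -> x != y.
Proof. by apply: contraTneq => ->; rewrite adj_irrefl. Qed.

Lemma mem_edges (x y : G) : adj x y -> [set x; y] \in edges G.
Proof. by move=> xy; apply/imsetP; exists (x, y) => //; rewrite inE. Qed.

Lemma incidentP (e : edge G) (x : G) :
  incident e x -> exists2 y, adj x y & val e = [set x; y].
Proof.
rewrite /incident; case: e => e /= /imsetP[[y z]]; rewrite inE /= => yz ->.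
rewrite !inE => /orP[]/eqP->; first by exists z.
by exists y; rewrite ?(adj_sym z) // setUC.
Qed.

Lemma card_incident (x : G) : #|[set e : edge G | incident e x]| = degree x.
Proof.
rewrite -(card_imset _ val_inj) /degree.
have -> : val @: [set e : edge G | incident e x] =
          [set [set x; y] | y in [set y | adj x y]].
  apply/setP => e; apply/imsetP/imsetP => [[f] | [y]]; rewrite inE.
    by case/incidentP => y xy ef ->; exists y; rewrite ?inE.
  move=> xy ->; exists (Sub [set x; y] (mem_edges x y xy)) => //.
  by rewrite inE /incident /= !inE eqxx.
rewrite card_in_imset // => y z; rewrite !inE => /adj_neq xy _.
exact: set2_inj.
Qed.

Lemma card_spectrum t (phi : {ffun edge G -> 'I_t.+1}) (x : G) :
  (forall e f, edge_adjacent e f -> phi e != phi f) ->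
  #|spectrum phi x| = degree x.
Proof.
move=> pr; rewrite card_in_imset ?card_incident // => e f.
rewrite !inE => ex fx eq_phi; apply: contraPeq eq_phi => ne; apply/eqP/pr.
by rewrite /edge_adjacent ne; apply/existsP; exists x; rewrite ex fx.
Qed.

(** The edges at [x] have distinct colors among the [t] nonzero ones. This yields the lower bound
    for [w hY]. *)
Lemma degree_le_colors t (phi : {ffun edge G -> 'I_t.+1}) (x : G) :
  proper_coloring phi -> degree x <= t.
Proof.
case/and3P => /forallP pos _ /forallP pr.
have <- : #|[set~ (ord0 : 'I_t.+1)]| = t by rewrite cardsC1 card_ord.
rewrite -(card_spectrum _ phi x); last first.
  by move=> e f; apply/implyP; apply: (forallP (pr e)).
apply/subset_leq_card/subsetP => _ /imsetP[e _ ->]; rewrite !inE.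
by have := pos e; rewrite lt0n.
Qed.

(* The p x + 1, ..., p x + degree x are distinct, so a proper coloring that
   takes its values there at x takes all of them. *)
Lemma interval_colorable_of_pairs (R : {set G}) t (h : G -> G -> nat)
    (p : G -> nat) :
    (forall x y, adj x y -> h x y = h y x) ->
    (forall x y z, adj x y -> adj x z -> h x y = h x z -> y = z) ->
    (forall x y, adj x y -> 0 < h x y <= t) ->
    {in R, forall x, 0 < degree x} ->
    {in R, forall x, p x + degree x <= t} ->
    {in R, forall x y, adj x y -> p x < h x y <= p x + degree x} ->
    (forall i, 0 < i <= t -> exists2 x, x \in R & p x < i <= p x + degree x) ->
  interval_colorable R t.
Proof.
move=> hsym hinj hrng dpos pt hp cover.
(* An edge is an unordered pair, so an order of its ends is chosen; symmetry of [h] makes the color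
   independent of it. *)
have pick_ex (e : edge G) :
    exists q : G * G, adj q.1 q.2 && (val e == [set q.1; q.2]).
  have /imsetP[q] := valP e; rewrite inE => aq eq.
  by exists q; rewrite aq eq eqxx.
pose q e := xchoose (pick_ex e).
pose phi : {ffun edge G -> 'I_t.+1} := [ffun e => inord (h (q e).1 (q e).2)].
have phiE (e : edge G) x y : adj x y -> val e = [set x; y] -> phi e = h x y :> nat.
  move=> xy ev; rewrite ffunE inordK; last first.
    by have /andP[/hrng/andP[_]] := xchooseP (pick_ex e).
  have /andP[] := xchooseP (pick_ex e); rewrite -/(q e) ev.
  case: (q e) => a b /= ab /eqP eq.
  have: a \in [set x; y] by rewrite eq !inE eqxx.
  rewrite !inE => /orP[]/eqP ax; subst a.
    by rewrite (set2_inj _ x y b) ?adj_neq.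
  have <- : x = b; last by rewrite hsym // adj_sym.
  by apply: (set2_inj _ y); rewrite 1?setUC // eq_sym adj_neq.
have sub x : x \in R ->
    spectrum phi x \subset [set c : 'I_t.+1 | p x < c <= p x + degree x].
  move=> xR; apply/subsetP => _ /imsetP[e + ->]; rewrite !inE.
  by case/incidentP => y xy /(phiE e x y xy) ->; apply: hp.
have proper_phi1 e f : edge_adjacent e f -> phi e != phi f.
  case/andP => ne /existsP[x /andP[/incidentP[y xy ey] /incidentP[z xz fz]]].
  apply: contraNneq ne => /(congr1 val) /=.
  rewrite (phiE e x y) // (phiE f x z) // => /hinj yz.
  by apply/eqP/val_inj; rewrite ey fz yz.
have spE x : x \in R ->
    spectrum phi x = [set c : 'I_t.+1 | p x < c <= p x + degree x].
  move=> xR; apply/eqP; rewrite eqEcard sub //= card_spectrum //.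
  (* [f] covers the target interval, which therefore has at most [degree x] elements, the size of
     the spectrum. *)
  pose f (j : 'I_(degree x)) : 'I_t.+1 := inord (p x + j.+1).
  rewrite -[leqRHS]card_ord -cardsT; apply: leq_trans (leq_imset_card f _).
  apply/subset_leq_card/subsetP => c; rewrite inE => /andP[pc cd].
  have jlt : c - (p x).+1 < degree x by lia.
  apply/imsetP; exists (Ordinal jlt); rewrite ?inE //.
  by apply/val_inj; rewrite /f /= inordK; have := ltn_ord c; lia.
apply/existsP; exists phi; apply/andP; split.
  apply/and3P; split.
  - apply/forallP => e; have /imsetP[[x y]] := valP e.
    rewrite inE /= => xy ev; rewrite (phiE e x y) //.
    by case/andP: (hrng _ _ xy).
  - apply/forallP => c; apply/implyP => c0.
    have [|x xR xc] := cover c; first by rewrite c0 -ltnS ltn_ord.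
    have: c \in spectrum phi x by rewrite spE // inE.
    by case/imsetP => e _ ->; apply/existsP; exists e.
  - by apply/forallP => e; apply/forallP => f; apply/implyP/proper_phi1.
apply/forallP => x; apply/implyP => xR; rewrite spE //.
have := dpos x xR; have := pt x xR => ple dgt.
apply/existsP; exists (inord (p x).+1); apply/existsP.
exists (inord (p x + degree x)); rewrite !inordK; try lia.
by apply/andP; split; [lia | apply/eqP/setP => c; rewrite !inE].
Qed.

(** Group [i] owns the [d] colors from [i * d + 1] on, so edges of different groups cannot clash;
    within one group all degrees are at most [d], and Koenig's theorem applies. *)
Lemma grouped_edge_coloring (X Y : {set G}) d r (g : G -> 'I_r) :
    bipartition X Y -> 0 < d ->
    {in X, forall x, degree x <= d} ->
    {in Y, forall y i, #|[set x in X | adj x y && (g x == i)]| <= d} ->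
  exists h : G -> G -> nat,
  [/\ forall x y, adj x y -> h x y = h y x,
      forall x y z, adj x y -> adj x z -> h x y = h x z -> y = z
    & forall x y, x \in X -> adj x y -> g x * d < h x y <= g x * d + d].
Proof.
case=> _ XY0 bip d0 dX dY.
have XnY z : z \in X -> z \in Y -> False.
  by move=> zX zY; have := in_set0 z; rewrite -XY0 inE zX zY.
(* Splitting each y into one copy per group lets a single application of
   Koenig's theorem color all groups at once. *)
pose E : {set G * (G * 'I_r)} :=
  [set u | [&& u.1 \in X, adj u.1 u.2.1 & u.2.2 == g u.1]].
have [x|[y i]|c [cX cY]] := @koenig_edge_coloring _ _ _ E (Ordinal d0).
- rewrite card_ord; case: (boolP (x \in X)) => xX; last first.
    by rewrite (_ : [set _ | _] = set0) ?cards0 //; apply/setP => u;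
       rewrite !inE (negPf xX).
  apply: leq_trans (dX x xX).
  rewrite /degree -(card_imset [set y | adj x y] (f := fun y => (y, g x))); last first.
    by move=> y z [].
  apply/subset_leq_card/subsetP => -[y i]; rewrite !inE /=.
  by case/and3P => _ xy /eqP ->; apply/imsetP; exists y; rewrite ?inE.
- rewrite card_ord; case: (boolP (y \in Y)) => yY; last first.
    rewrite (_ : [set _ | _] = set0) ?cards0 //; apply/setP => x.
    rewrite !inE /=; apply/negP => /and3P[xX xy _].
    by case/bip: xy => -[xY' yY']; [rewrite yY' in yY | exact: (XnY x)].
  apply: leq_trans (dY y yY i).
  apply/subset_leq_card/subsetP => x; rewrite !inE /=.
  by case/and3P => -> -> /eqP ->; rewrite eqxx.
pose H x y := g x * d + (c x (y, g x)).+1.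
have Hrng x y : g x * d < H x y <= g x * d + d.
  by rewrite /H; have := ltn_ord (c x (y, g x)); lia.
have HE x y : x \in X -> adj x y -> (x, (y, g x)) \in E.
  by move=> xX xy; rewrite inE /= xX xy eqxx.
(* The color determines its block, hence the group. *)
have Hg x x' y : H x y = H x' y -> g x = g x' :> nat.
  have gE z : g z = (H z y).-1 %/ d :> nat.
    by rewrite /H addnS /= divnMDl // divn_small ?addn0.
  by move=> e; rewrite (gE x) (gE x') e.
exists (fun x y => if x \in X then H x y else H y x); split.
- move=> x y xy; case: (bip x y xy) => -[xX yY]; rewrite ?xX ?yY.
    by case: ifP => // yX; case: (XnY y).
  by case: ifP => // xX'; case: (XnY x).
- move=> x y z xy xz; case: ifP => xX.
    move/eqP; rewrite /H eqn_add2l eqSS => /eqP/val_inj e.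
    by have [] := cX x _ _ (HE x y xX xy) (HE x z xX xz) e.
  have inX u : adj x u -> u \in X.
    by case/bip => -[] //; rewrite xX.
  (* Here [x] is in [Y]: equal colors put both edges in one group, so they meet in the same copy of
     [x]. *)
  move=> e; have /val_inj eg := Hg _ _ _ e.
  move/eqP: e; rewrite /H eg eqn_add2l eqSS => /eqP/val_inj e.
  apply: (cY _ _ (x, g z)) e; last by apply: HE; rewrite ?inX // adj_sym.
  by rewrite -eg; apply: HE; rewrite ?inX // adj_sym.
- by move=> x y xX xy; rewrite xX.
Qed.

End GraphColoring.

(** Bounds the number of groups, [(m.-1 %/ l).+1], by the ceiling: the quotient times [l] is at most
    [m.-1], below [m]. *)
Lemma ltz_ceil_div (m l : nat) : 0 < m -> 0 < l ->
  ((m.-1 %/ l)%:Z < Num.ceil (m%:Q / l%:Q))%R.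
Proof.
move=> m0 l0; rewrite Num.Theory.ceil_gt_int.
rewrite Num.Theory.ltr_pdivlMr ?Num.Theory.ltr0n //.
rewrite -!pmulrn -GRing.natrM Num.Theory.ltr_nat.
by have := leq_divM m.-1 l; lia.
Qed.

(** * The colorings that are interval on [Y] and on [X] *)

Lemma interval_colorable_Y (m l n k : nat) (G : sgraph) (X Y : {set G}) :
  Bip m l n k X Y -> 0 < n -> 0 < k -> l <= k -> interval_colorable Y k.
Proof.
case=> bip cX cY dX dY n0 k0 lk.
(* A single group with the [k] colors [1] to [k]. *)
have [|x xX|y yY i|h [hsym hinj hrng]] :=
    grouped_edge_coloring _ X Y k 1 (fun=> ord0) bip.
- by [].
- by rewrite dX.
- rewrite -(dY y yY); apply/subset_leq_card/subsetP => x.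
  by rewrite !inE adj_sym => /and3P[].
have hk x y : adj x y -> 0 < h x y <= k.
  move=> xy; case: bip => _ _ /(_ x y xy) [[xX _]|[_ yX]].
    exact: hrng.
  by rewrite hsym //; apply: hrng; rewrite // adj_sym.
apply: (interval_colorable_of_pairs _ _ _ h (fun=> 0)) => //.
- by move=> x /dY ->.
- by move=> x /dY ->.
- by move=> x xY y xy; rewrite dY //; apply: hk.
- have /card_gt0P[y yY] : 0 < #|Y| by rewrite cY.
  by move=> i ik; exists y; rewrite // dY.
Qed.

Lemma interval_colorable_X (m l n k : nat) (G : sgraph) (X Y : {set G}) :
  Bip m l n k X Y -> 0 < m -> 0 < l ->
  interval_colorable X (l * (m.-1 %/ l).+1).
Proof.
case=> bip cX cY dX dY m0 l0.
pose idx x := index x (enum X).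
have idxlt x : x \in X -> idx x < m.
  by move=> xX; rewrite -cX cardE index_mem mem_enum.
(* Groups are runs of [l] consecutive vertices in [enum X]; the last index is [m.-1]. *)
pose g x : 'I_(m.-1 %/ l).+1 := inord (idx x %/ l).
have gE x : x \in X -> g x = idx x %/ l :> nat.
  move=> xX; rewrite inordK // ltnS leq_div2r //.
  by have := idxlt x xX; lia.
have [|x xX|y yY i|h [hsym hinj hrng]] :=
    grouped_edge_coloring _ X Y l _ g bip.
- by [].
- by rewrite dX.
(* Within a group the index modulo [l] identifies the vertex, so a group has at most [l]
   vertices. *)
- pose f x : 'I_l := Ordinal (ltn_pmod (idx x) l0).
  rewrite -[leqRHS]card_ord -(card_in_imset (f := f)) ?max_card // => x x'.
  rewrite !inE => /and3P[xX _ /eqP gx] /and3P[x'X _ /eqP gx'] [eqm].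
  have eqd : idx x %/ l = idx x' %/ l by rewrite -!gE // gx gx'.
  have: idx x = idx x' by rewrite (divn_eq (idx x) l) eqd eqm -divn_eq.
  by apply: (@index_inj _ x (enum X)); rewrite ?mem_enum.
have gl x : g x * l + l <= l * (m.-1 %/ l).+1.
  by have := ltn_ord (g x); rewrite [g x * l]mulnC addnC -mulnS leq_pmul2l.
have hX x y : x \in X -> adj x y -> 0 < h x y <= l * (m.-1 %/ l).+1.
  move=> xX xy; have /andP[hl hr] := hrng x y xX xy.
  by rewrite (leq_trans hr (gl x)) andbT (leq_ltn_trans _ hl).
apply: (interval_colorable_of_pairs _ _ _ h (fun x => g x * l)) => //.
- move=> x y xy; case: bip => _ _ /(_ x y xy) [[xX _]|[_ yX]].
    exact: hX.
  by rewrite hsym //; apply: hX; rewrite // adj_sym.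
- by move=> x /dX ->.
- by move=> x /dX ->.
- by move=> x xX y xy; rewrite dX //; apply: hrng.
(* Color [i] lies in block [i.-1 %/ l]. The first vertex of that group, of index [i.-1 %/ l * l],
   exists and sees the whole block. *)
- move=> i /andP[i0 il].
  have il' : i.-1 %/ l <= m.-1 %/ l by rewrite -ltnS ltn_divLR // mulnC; lia.
  have lt : i.-1 %/ l * l < m.
    by have := leq_divM m.-1 l; have : i.-1 %/ l * l <= m.-1 %/ l * l;
       [rewrite leq_pmul2r | lia].
  have /card_gt0P[x0 _] : 0 < #|X| by rewrite cX.
  have szX : size (enum X) = m by rewrite -cardE.
  exists (nth x0 (enum X) (i.-1 %/ l * l)).
    by rewrite -mem_enum mem_nth ?szX.
  rewrite dX ?gE; try by rewrite -mem_enum mem_nth ?szX.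
  rewrite /idx index_uniq ?enum_uniq ?szX // mulnK //.
  have := divn_eq i.-1 l; have := ltn_pmod i.-1 l0; lia.
Qed.

Theorem theorem3 (m l n k : nat) (G : sgraph) (X Y : {set G})
    (hm : 0 < m) (hl : 0 < l) (hn : 0 < n) (hk : 0 < k)
    (hmn : n <= m) (hmlnk : m * l = n * k)
    (hG : Bip m l n k X Y) :
  exists (hY : i_property Y) (hX : i_property X),
    w hY = k /\
    ((w hX)%:Z <= l%:Z * Num.ceil (m%:Q / l%:Q))%R.
Proof.
have lk : l <= k by rewrite -(leq_pmul2l hn) -hmlnk leq_pmul2r.
have colY : interval_colorable Y k by apply: interval_colorable_Y hG _ _ _.
have colX := interval_colorable_X _ _ _ _ _ _ _ hG hm hl.
exists (ex_intro (interval_colorable Y) k colY), (ex_intro (interval_colorable X) _ colX); split.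
(* [colY] gives at most [k]; a vertex of [Y], of degree [k], gives at least [k]. *)
- rewrite /w; case: ex_minnP => t /existsP[phi /andP[pr _]] minY.
  apply/eqP; rewrite eqn_leq minY //=; case: hG => _ _ cY _ dY.
  have /card_gt0P[y yY] : 0 < #|Y| by rewrite cY.
  by rewrite -(dY y yY); apply: degree_le_colors pr.
- rewrite /w; case: ex_minnP => t _ /(_ _ colX) tle.
  apply: (Order.POrderTheory.le_trans (y := (l * (m.-1 %/ l).+1)%:Z%R)) => //.
  rewrite PoszM Num.Theory.ler_pM2l ?ltz_nat //.
  by have := ltz_ceil_div m l hm hl; lia.
Qed.
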